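(* All odd-order correlations of the balanced Thue--Morse system vanish: for every odd $n\in\mathbb{N}$ and all integers $m_1,\ldots,m_{n-1}$, one has $\eta(m_1,\ldots,m_{n-1})=0$ (for $n=1$, this reads $\int_{\mathbb{X}} x_0\,\mathrm{d}\mu(x)=0$).
   Context: The Thue--Morse sequence $(t_k)_{k\geqslant 0}$ with values $\pm1$ is defined by $t_0=1$, $t_{2k}=t_k$, $t_{2k+1}=-t_k$ for $k\geqslant 0$. Its bi-infinite extension is $w=(w_n)_{n\in\mathbb{Z}}$ with $w_n=t_n$ for $n\geqslant 0$ and $w_n=t_{-n-1}$ for $n<0$. Let $(Sx)_i=x_{i+1}$ be the shift on $\{\pm1\}^{\mathbb{Z}}$ and let $\mathbb{X}=\overline{\{S^iw:i\in\mathbb{Z}\}}\subset\{\pm1\}^{\mathbb{Z}}$ (closure in the product topology). It is a known fact that $(\mathbb{X},\mathbb{Z})$ is strictly ergodic (minimal and uniquely ergodic); $\mu$ denotes its unique shift-invariant probability measure. The (balanced) $n$-point correlations are $$\eta(m_1,\ldots,m_{n-1})=\int_{\mathbb{X}}x_0\,x_{m_1}\cdots x_{m_{n-1}}\,\mathrm{d}\mu(x)=\lim_{N\to\infty}\frac1N\sum_{k=0}^{N-1}w_kw_{k+m_1}\cdots w_{k+m_{n-1}},\qquad m_i\in\mathbb{Z}.$$ *)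

(* Defs.v *)
From HB Require Import structures.
From mathcomp Require Import all_boot all_order all_algebra.
From mathcomp Require Import all_classical all_reals all_analysis.
From mathcomp Require Import zify.

Set Implicit Arguments.
Unset Strict Implicit.
Unset Printing Implicit Defensive.

Import Order.TTheory GRing.Theory Num.Theory.
Import numFieldNormedType.Exports.

Local Open Scope classical_set_scope.
Local Open Scope ring_scope.

(* [k./2 <= f] whenever [k <= f.+1], so fuel [k] suffices for [thue_morse k];
   the defining recursion is recovered in [thue_morse0], [thue_morse_even] and
   [thue_morse_odd]. *)
Fixpoint tm_rec (fuel k : nat) : int :=
  if fuel isn't f.+1 then 1
  else if odd k then - tm_rec f k./2 else tm_rec f k./2.

Definition thue_morse (k : nat) : int := tm_rec k k.

Lemma tm_rec_fuel f g k : (k <= f)%N -> (k <= g)%N -> tm_rec f k = tm_rec g k.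
Proof.
have H0 h : tm_rec h 0 = 1 by elim: h.
elim: f g k => [|f IH] [|g] k; rewrite ?leqn0 //.
- by move=> /eqP-> _; rewrite !H0.
- by move=> _ /eqP->; rewrite !H0.
move=> kf kg /=; have hb h : (k <= h.+1)%N -> (k./2 <= h)%N.
  by lia.
by rewrite (IH g) ?hb.
Qed.

Lemma thue_morse0 : thue_morse 0 = 1.
Proof. by []. Qed.

Lemma thue_morse_even k : thue_morse (2 * k) = thue_morse k.
Proof.
have H f : (2 * k <= f)%N -> tm_rec f (2 * k) = thue_morse k.
  case: f => [|f] kf; first by rewrite (_ : k = 0)%N //; lia.
  rewrite /= mul2n odd_double doubleK; apply: tm_rec_fuel; lia.
exact: H.
Qed.

Lemma thue_morse_odd k : thue_morse (2 * k + 1) = - thue_morse k.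
Proof.
have H f : (2 * k + 1 <= f)%N -> tm_rec f (2 * k + 1) = - thue_morse k.
  case: f => [|f] kf; first by lia.
  rewrite /= mul2n addn1 /= odd_double uphalf_double.
  by congr (- _); apply: tm_rec_fuel; lia.
exact: H.
Qed.

Definition pm1 : Type := {a : int | (a == 1) || (a == -1)}.

HB.instance Definition _ := Choice.on pm1.
HB.instance Definition _ := isPointed.Build pm1 (exist _ 1 isT).

Lemma thue_morse_pm1 k : (thue_morse k == 1) || (thue_morse k == -1).
Proof.
suff H f j : (tm_rec f j == 1) || (tm_rec f j == -1) by exact: H.
elim: f j => [//|f IH] j /=.
by case: ifP => // _; case/orP: (IH j./2) => /eqP->.
Qed.

Definition tm_letter (k : nat) : pm1 :=
  exist _ (thue_morse k) (thue_morse_pm1 k).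

(* {+1,-1}^Z with the product of the discrete topologies *)
Definition full_shift : Type :=
  prod_topology (fun _ : int => discrete_topology pm1).

HB.instance Definition _ := Pointed.on full_shift.
HB.instance Definition _ := Topological.on full_shift.

Definition letter (x : full_shift) (i : int) : int := val (x i : pm1).

(* [Negz k] is the integer -k-1, so that w_n = t_{-n-1} for n < 0. *)
Definition tm_word : full_shift := fun n : int =>
  match n with Posz k => tm_letter k | Negz k => tm_letter k end.

(* the [k]-th power S^k of the shift map *)
Definition shift_pow (k : int) (x : full_shift) : full_shift :=
  fun i => x (i + k).

Definition tm_hull : set full_shift := closure [set shift_pow i tm_word | i in setT].

Definition borel_full_shift := g_sigma_algebraType (@open full_shift).

(* Invariant Borel probability measures on the closed set [tm_hull] are
   encoded as those on the full shift that give it mass 1. *)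
Definition tm_invariant_measure (R : realType)
    (mu : probability borel_full_shift R) : Prop :=
  mu tm_hull = 1%E /\
  (forall A : set borel_full_shift, measurable A ->
     mu (shift_pow 1 @^-1` A) = mu A).

(* x_k x_{k+m_1} ... x_{k+m_r} *)
Definition corr_prod (r : nat) (m : 'I_r -> int) (x : full_shift) (k : int) :
    int :=
  letter x k * \prod_(i < r) letter x (k + m i).

Definition eta (R : realType) (mu : probability borel_full_shift R)
    (r : nat) (m : 'I_r -> int) : \bar R :=
  (\int[mu]_(x in tm_hull) ((corr_prod m x 0)%:~R)%:E)%E.

Definition eta_average (R : realType) (r : nat) (m : 'I_r -> int) (N : nat) : R :=
  N%:R^-1 * \sum_(0 <= k < N) (corr_prod m tm_word k%:Z)%:~R.

(* Main.v *)
(* The Thue-Morse word is a concatenation of blocks of length D = 4^j, the q-th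
   one being w_q times the block at the origin.  If all the shifts are at most M
   in absolute value, a product of an odd number of shifted letters at
   D q + s with M <= s < D - M therefore equals w_q times a constant depending
   only on s; since the sums of w over intervals are bounded by 2, such positions
   contribute O(D) to a window sum.  The other positions have density at most
   2M/D.  Hence the averages over windows of length N tend to 0 uniformly in the
   position of the window, thus uniformly on the hull, and integrating an average
   against an invariant measure gives the value of the correlation. *)
Require Import Defs.
From mathcomp Require Import all_boot all_order all_algebra.
From mathcomp Require Import all_classical all_reals all_analysis.
From mathcomp Require Import measurable_realfun zify ring lra.
Import Order.TTheory GRing.Theory Num.Theory.
Import numFieldNormedType.Exports.
Local Open Scope classical_set_scope.
Local Open Scope ring_scope.

(** * Letters and correlation products as signs *)

Lemma letter_cases x i : letter x i = 1 \/ letter x i = -1.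
Proof. by rewrite /letter; case: (x i) => a /= /orP[] /eqP ->; [left|right]. Qed.

Lemma letter_sqr x i : letter x i * letter x i = 1.
Proof. by case: (letter_cases x i) => ->. Qed.

Lemma normr_letter x i : `|letter x i| = 1.
Proof. by case: (letter_cases x i) => ->. Qed.

Lemma normr_corr_prod r (m : 'I_r -> int) x k : `|corr_prod m x k| = 1.
Proof.
rewrite /corr_prod normrM normr_letter mul1r normr_prod big1 // => i _.
exact: normr_letter.
Qed.

(** * Self-similarity of the Thue-Morse word *)

Local Notation w := (letter tm_word).

Lemma tm_word_pos (k : nat) : w k%:Z = thue_morse k.
Proof. by []. Qed.

Lemma tm_word_neg (k : nat) : w (- k%:Z - 1) = thue_morse k.
Proof. by have -> : - k%:Z - 1 = Negz k by rewrite NegzE; lia. Qed.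

Lemma thue_morse_subst4 (k : nat) :
  [/\ thue_morse (4 * k) = thue_morse k,
      thue_morse (4 * k + 1) = - thue_morse k,
      thue_morse (4 * k + 2) = - thue_morse k &
      thue_morse (4 * k + 3) = thue_morse k].
Proof.
have E : (4 * k = 2 * (2 * k))%N by lia.
have E2 : (4 * k + 2 = 2 * (2 * k + 1))%N by lia.
have E3 : (4 * k + 3 = 2 * (2 * k + 1) + 1)%N by lia.
by rewrite E3 E2 E !(thue_morse_even, thue_morse_odd) opprK.
Qed.

(* On the negative half-line w_(2q) = - w_q, so w is only fixed by the square of
   the Thue-Morse substitution; hence the powers of 4. *)
Lemma tm_word_subst4 (q : int) :
  [/\ w (4 * q) = w q, w (4 * q + 1) = - w q,
      w (4 * q + 2) = - w q & w (4 * q + 3) = w q].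
Proof.
have [k [->|->]] : exists k : nat, q = k%:Z \/ q = - k%:Z - 1.
  case: q => k; exists k; [by left | by right; rewrite NegzE; lia].
- have [t0 t1 t2 t3] := thue_morse_subst4 k.
  have -> : 4 * k%:Z = (4 * k)%N%:Z by lia.
  by rewrite -!PoszD !tm_word_pos.
- have [t0 t1 t2 t3] := thue_morse_subst4 k.
  have -> : 4 * (- k%:Z - 1) = - (4 * k + 3)%N%:Z - 1 by lia.
  have -> : - (4 * k + 3)%N%:Z - 1 + 1 = - (4 * k + 2)%N%:Z - 1 by lia.
  have -> : - (4 * k + 3)%N%:Z - 1 + 2 = - (4 * k + 1)%N%:Z - 1 by lia.
  have -> : - (4 * k + 3)%N%:Z - 1 + 3 = - (4 * k)%N%:Z - 1 by lia.
  by rewrite !tm_word_neg.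
Qed.

(** Induction on [j], peeling off the last base-4 digit of [r]: by [tm_word_subst4] this digit
    contributes the same sign to both sides. *)
Lemma tm_word_block (j r : nat) (q : int) : (r < 4 ^ j)%N ->
  w ((4 ^ j)%N%:Z * q + r%:Z) = w q * w r%:Z.
Proof.
elim: j r q => [|j IH] r q rj.
  have -> : r = 0%N by move: rj; rewrite expn0; lia.
  by rewrite mul1r addr0 mulr1.
have rE : r = (4 * (r %/ 4) + r %% 4)%N by rewrite mulnC -divn_eq.
have r4 : (r %/ 4 < 4 ^ j)%N by rewrite ltn_divLR // mulnC -expnS.
have s4 : (r %% 4 < 4)%N by rewrite ltn_mod.
have [a0 a1 a2 a3] := tm_word_subst4 ((4 ^ j)%N%:Z * q + (r %/ 4)%N%:Z).
have [b0 b1 b2 b3] := tm_word_subst4 (r %/ 4)%N%:Z.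
have -> : (4 ^ j.+1)%N%:Z * q + r%:Z =
    4 * ((4 ^ j)%N%:Z * q + (r %/ 4)%N%:Z) + (r %% 4)%N%:Z.
  have -> : (4 ^ j.+1)%N%:Z = 4 * (4 ^ j)%N%:Z by rewrite expnS; lia.
  lia.
have -> : r%:Z = 4 * (r %/ 4)%N%:Z + (r %% 4)%N%:Z by lia.
move: (r %% 4)%N s4 => [|[|[|[|//]]]] _.
- by rewrite !addr0 a0 b0 IH.
- by rewrite a1 b1 IH // mulrN.
- by rewrite a2 b2 IH // mulrN.
- by rewrite a3 b3 IH.
Qed.

(** The two positions are the first or the last half of an aligned block of length 4, whose sign
    pattern [+ - - +] cancels on each half. *)
Lemma tm_word_pair (q : int) : w (2 * q) + w (2 * q + 1) = 0.
Proof.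
have [p [->|->]] : exists p : int, q = 2 * p \/ q = 2 * p + 1.
  exists (q %/ 2)%Z; lia.
- have [a0 a1 _ _] := tm_word_subst4 p.
  have -> : 2 * (2 * p) = 4 * p by ring.
  by rewrite a0 a1 subrr.
- have [_ _ a2 a3] := tm_word_subst4 p.
  have -> : 2 * (2 * p + 1) = 4 * p + 2 by ring.
  have -> : 4 * p + 2 + 1 = 4 * p + 3 by ring.
  by rewrite a2 a3 addNr.
Qed.

(** * Bounds for sums over windows of the word *)

Lemma tm_word_sum_bound (a : int) (K : nat) :
  `|\sum_(0 <= k < K) w (a + k%:Z)| <= 2.
Proof.
(* [G] is a bounded discrete primitive of [w]. *)
pose G (n : int) : int := if (n == 2 * (n %/ 2)%Z) then 0 else w (n - 1).
have G1 n : `|G n| <= 1 by rewrite /G; case: ifP => _ //; rewrite normr_letter.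
have Gw n : w n = G (n + 1) - G n.
  rewrite /G; have := tm_word_pair (n %/ 2)%Z.
  case: ifPn => [e1|e1]; case: ifPn => [e2|e2]; try lia.
  - have -> : 2 * (n %/ 2)%Z = n - 1 by lia.
    rewrite subrK; lia.
  - by move=> _; rewrite addrK subr0.
have -> : \sum_(0 <= k < K) w (a + k%:Z)
    = \sum_(0 <= k < K) (G (a + k.+1%:Z) - G (a + k%:Z)).
  by apply: eq_bigr => k _; rewrite Gw; congr (G _ - _); lia.
rewrite (telescope_sumr (fun k : nat => G (a + k%:Z))) //.
have := G1 (a + K%:Z); have := G1 (a + 0%:Z); lia.
Qed.

(** The margin [M] keeps all [r + 1] positions inside the [q]-th block, so each letter picks up a
    factor [w q]; since [r + 1] is odd, these factors multiply to [w q]. *)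
Lemma corr_prod_block r (m : 'I_r -> int) (M j s : nat) (q : int) :
  ~~ odd r -> (forall i, `|m i| <= M%:Z) -> (M <= s)%N -> (s + M < 4 ^ j)%N ->
  corr_prod m tm_word ((4 ^ j)%N%:Z * q + s%:Z) =
    w q * corr_prod m tm_word s%:Z.
Proof.
move=> r_even mM Ms sM.
rewrite /corr_prod tm_word_block; last by lia.
rewrite -mulrA; congr (_ * (_ * _)).
have E (i : 'I_r) : w ((4 ^ j)%N%:Z * q + s%:Z + m i) = w q * w (s%:Z + m i).
  have := mM i => mi.
  (* [M <= s] makes the offset nonnegative, hence a natural number as [tm_word_block] requires. *)
  have -> : s%:Z + m i = (absz (s%:Z + m i))%:Z by lia.
  by rewrite -(tm_word_block j); [congr (w _); lia | lia].
rewrite (eq_bigr _ (fun i _ => E i)) big_split /= prodr_const card_ord.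
have -> : (w q) ^+ r = 1.
  by rewrite -[r]odd_double_half (negPf r_even) -mul2n exprM expr2 letter_sqr expr1n.
by rewrite mul1r.
Qed.

Lemma big_nat_blocks (V : nmodType) (F : nat -> V) (D K : nat) :
  \sum_(0 <= k < D * K) F k =
  \sum_(0 <= s < D) \sum_(0 <= q < K) F (D * q + s)%N.
Proof.
elim: K => [|K IH].
  by rewrite muln0 big_geq // big1 // => s _; rewrite big_geq.
rewrite mulnS addnC (big_cat_nat (n := (D * K)%N)) ?leq_addr //= IH.
rewrite [in RHS](eq_bigr _ (fun s _ => big_nat_recr _ _ _ (leq0n K))) big_split /=.
congr (_ + _); rewrite -{1}[(D * K)%N]add0n big_addn addKn.
by apply: eq_bigr => s _; rewrite addnC.
Qed.

Lemma ler_norm_sum_card (F : nat -> int) (K : nat) :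
  (forall k, `|F k| <= 1) -> `|\sum_(0 <= k < K) F k| <= K%:Z.
Proof.
move=> F1; elim: K => [|K IH]; first by rewrite big_geq.
rewrite big_nat_recr //= -addn1 PoszD.
exact: le_trans (ler_normD _ _) (lerD IH (F1 K)).
Qed.

(** Sum over the blocks first, with the offset [s] fixed: an interior offset gives at most 2 by
    [tm_word_sum_bound], an offset in one of the two margins at most [K] trivially, and each margin
    has at most [M] offsets. *)
Lemma corr_prod_aligned_bound r (m : 'I_r -> int) (M j K : nat) (a : int) :
  ~~ odd r -> (forall i, `|m i| <= M%:Z) ->
  `|\sum_(0 <= k < 4 ^ j * K) corr_prod m tm_word ((4 ^ j)%N%:Z * a + k%:Z)|
    <= 2 * (4 ^ j)%N%:Z + 2 * M%:Z * K%:Z.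
Proof.
move=> r_even mM; set D := (4 ^ j)%N.
rewrite (big_nat_blocks int).
apply: (le_trans (ler_norm_sum _ _ _)).
have count_lt n : \sum_(0 <= s < n) ((s < M)%N : int) <= M%:Z.
  (* [M] may exceed the number of offsets, hence the minimum. *)
  have -> : \sum_(0 <= s < n) ((s < M)%N : int) = (minn n M)%:Z.
    elim: n => [|n IH]; first by rewrite big_geq // min0n.
    by rewrite big_nat_recr //= IH; lia.
  lia.
(* The indicators mark the left and right margins; for small [D] these may overlap, which only
   weakens the bound. *)
apply: (@le_trans _ _ (\sum_(0 <= s < D)
   (2 + K%:Z * ((s < M)%N : int) + K%:Z * ((D - s.+1 < M)%N : int)))).
  rewrite !big_nat; apply: ler_sum => s /andP[_ sD].
  have triv : `|\sum_(0 <= q < K) corr_prod m tm_word (D%:Z * a + (D * q + s)%N%:Z)|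
     <= K%:Z.
    by apply: (@ler_norm_sum_card
      (fun q => corr_prod m tm_word (D%:Z * a + (D * q + s)%N%:Z))) => q;
      rewrite normr_corr_prod.
  have [sM|Ms] := ltnP s M; first by apply: le_trans triv _; case: ltnP; lia.
  have [sM|Ms'] := ltnP (D - s.+1) M; first by apply: le_trans triv _; lia.
  rewrite (eq_bigr (fun q => w (a + q%:Z) * corr_prod m tm_word s%:Z)); last first.
    move=> q _; rewrite -(corr_prod_block r m M j s _ r_even mM Ms).
      2: by rewrite -/D; lia.
    by congr corr_prod; rewrite -/D PoszD PoszM mulrDr addrA.
  rewrite -mulr_suml normrM normr_corr_prod mulr1 !mulr0 !addr0.
  exact: tm_word_sum_bound.
rewrite !big_split /= -!mulr_sumr sumr_const_nat subn0.
(* The reversal [s -> D - 1 - s] exchanges the two margins. *)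
have -> : \sum_(0 <= s < D) ((D - s.+1 < M)%N : int) =
    \sum_(0 <= s < D) ((s < M)%N : int).
  rewrite big_nat_rev /= !big_nat; apply: eq_bigr => s sD.
  by congr ((_ < _)%N : int); lia.
have := count_lt D; set c := (\sum_(0 <= s < D) _) => cM.
have : K%:Z * c <= K%:Z * M%:Z by apply: ler_wpM2l.
lia.
Qed.

(** Each unit translation drops one term and gains one, so it changes the sum by at most 2. *)
Lemma window_shift_bound (F : int -> int) (a : int) (d N : nat) :
  (forall k, `|F k| <= 1) ->
  `|\sum_(0 <= k < N) F (a + d%:Z + k%:Z) - \sum_(0 <= k < N) F (a + k%:Z)|
    <= 2 * d%:Z.
Proof.
move=> F1; elim: d => [|d IH]; first by rewrite addr0 subrr.
have E : \sum_(0 <= k < N) F (a + d.+1%:Z + k%:Z) =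
   \sum_(0 <= k < N) F (a + d%:Z + k%:Z) + F (a + d%:Z + N%:Z) - F (a + d%:Z).
  have := erefl (\sum_(0 <= k < N.+1) F (a + d%:Z + k%:Z)).
  rewrite {1}big_nat_recr //= big_nat_recl //= addr0 => ->.
  rewrite [F _ + _]addrC addrK; apply: eq_bigr => k _; congr F; lia.
rewrite E; have := F1 (a + d%:Z + N%:Z); have := F1 (a + d%:Z); lia.
Qed.

(** With [D = 4 ^ j], the 5 is 2 + 1 + 2: the complete aligned blocks give [2 D], the incomplete
    last block has fewer than [D] terms, and moving the start of the window to a multiple of [D]
    costs at most [2 D]. *)
Lemma corr_prod_window_bound r (m : 'I_r -> int) (M j N : nat) (a : int) :
  ~~ odd r -> (forall i, `|m i| <= M%:Z) ->
  `|\sum_(0 <= k < N) corr_prod m tm_word (a + k%:Z)|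
    <= 5 * (4 ^ j)%N%:Z + 2 * M%:Z * (N %/ 4 ^ j)%N%:Z.
Proof.
move=> r_even mM; set D := (4 ^ j)%N.
have D0 : (0 < D)%N by rewrite expn_gt0.
have F1 k : `|corr_prod m tm_word k| <= 1 by rewrite normr_corr_prod.
have aE := divz_eq a D%:Z.
have dE : (a %% D%:Z)%Z = `|(a %% D%:Z)%Z|%N%:Z by have := @modz_ge0 a D%:Z; lia.
have dD : (a %% D%:Z)%Z < D%:Z by apply: ltz_pmod; lia.
have := window_shift_bound (corr_prod m tm_word) (D%:Z * (a %/ D%:Z)%Z)
  `|(a %% D%:Z)%Z|%N N F1.
rewrite -dE [D%:Z * _]mulrC -aE [(a %/ D%:Z)%Z * _]mulrC.
set S := \sum_(0 <= k < N) corr_prod m tm_word (a + _); set a' := (_ %/ _)%Z.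
have := corr_prod_aligned_bound r m M j (N %/ D) a' r_even mM.
rewrite -/D.
have NE := divn_eq N D; have ND : (N %% D < D)%N by rewrite ltn_mod.
have -> : \sum_(0 <= k < N) corr_prod m tm_word (D%:Z * a' + k%:Z) =
  \sum_(0 <= k < D * (N %/ D)) corr_prod m tm_word (D%:Z * a' + k%:Z) +
  \sum_(0 <= k < N %% D)
    corr_prod m tm_word (D%:Z * a' + (k + D * (N %/ D))%N%:Z).
  rewrite {1}NE mulnC (big_cat_nat (n := (D * (N %/ D))%N)) ?leq_addr //=.
  by rewrite -{2}[(D * _)%N]add0n big_addn addKn.
have := ler_norm_sum_card
  (fun k => corr_prod m tm_word (D%:Z * a' + (k + D * (N %/ D))%N%:Z)) (N %% D)
  (fun k => F1 _).
lia.
Qed.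

Lemma corr_prod_average_small (R : realType) r (m : 'I_r -> int) (e : R) :
  ~~ odd r -> 0 < e ->
  exists N0 : nat, forall (N : nat) (a : int), (N0 <= N)%N ->
    `|(\sum_(0 <= k < N) corr_prod m tm_word (a + k%:Z))%:~R : R| <= e * N%:R.
Proof.
move=> r_even e0.
pose M := \max_(i < r) `|m i|%N.
have mM i : `|m i| <= M%:Z.
  by have := leq_bigmax (F := fun i => `|m i|%N) i; rewrite -/M; lia.
(* Since [j <= 4 ^ j = D], this choice gives [4 M <= e D], so the margins contribute at most
   [e N / 2]. *)
pose j := Num.bound (4 * M%:R / e).
have j_gt : 4 * M%:R / e < j%:R.
  by apply: archi_boundP; rewrite divr_ge0 ?mulr_ge0 // ltW.
have jD : (j <= 4 ^ j)%N by rewrite ltnW // ltn_expl.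
set D := (4 ^ j)%N in jD.
have D0 : (0 < D)%N by rewrite expn_gt0.
(* For [N >= N0] the remaining [5 D] is at most the other [e N / 2]. *)
pose N0 := Num.bound (10 * D%:R / e).
have N0_gt : 10 * D%:R / e < N0%:R.
  by apply: archi_boundP; rewrite divr_ge0 ?mulr_ge0 // ltW.
exists N0 => N a N0N.
rewrite -intr_norm.
have := corr_prod_window_bound r m M j N a r_even mM; rewrite -/D.
rewrite -(ler_int R) => /le_trans; apply.
rewrite intrD !intrM -!pmulrn.
have N0N' : N0%:R <= N%:R :> R by rewrite ler_nat.
have : 10 * D%:R <= e * N%:R :> R.
  have := ler_wpM2r (ltW e0) N0N'; move/ltW: N0_gt; rewrite ler_pdivrMr //; lra.
have h : (N %/ D)%N%:R * D%:R <= N%:R :> R by rewrite -natrM ler_nat leq_trunc_div.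
have hD : 4 * M%:R <= e * D%:R :> R.
  have jD' : j%:R <= D%:R :> R by rewrite ler_nat.
  have := ler_wpM2r (ltW e0) jD'; move/ltW: j_gt; rewrite ler_pdivrMr //; lra.
have := ler_wpM2r (ler0n R (N %/ D)) hD.
have := ler_wpM2l (ltW e0) h.
nra.
Qed.

(** * Continuity and measurability on the full shift *)

Lemma continuous_coord (i : int) :
  continuous (fun x : full_shift => x i : discrete_topology pm1).
Proof. exact: (@proj_continuous int (fun=> discrete_topology pm1) i). Qed.

Lemma continuous_letter (R : realType) (i : int) :
  continuous (fun x : full_shift => (letter x i)%:~R : R).
Proof.
apply/continuousP => A _.
have := iffLR (continuousP _) (continuous_coord i) [set a | A (val (a : pm1))%:~R].
apply; exact: discrete_open.
Qed.

Lemma continuous_corr_prod (R : realType) r (m : 'I_r -> int) (k : int) :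
  continuous (fun x : full_shift => (corr_prod m x k)%:~R : R).
Proof.
have -> : (fun x : full_shift => (corr_prod m x k)%:~R : R) =
    (fun x : full_shift => ((letter x k)%:~R : R) *
       \prod_(i < r) (letter x (k + m i))%:~R).
  by apply/funext => x; rewrite /corr_prod intrM rmorph_prod.
move=> x; apply: (@continuousM R full_shift); first exact: continuous_letter.
apply: (@continuous_big R _ _ 1 xpredT (@mul_continuous R)) => i _.
exact: continuous_letter.
Qed.

Lemma continuous_measurable_full_shift (R : realType) (f : full_shift -> R) :
  continuous f -> measurable_fun [set: borel_full_shift] (f : borel_full_shift -> R).
Proof.
move=> fcts.
apply: (measurability _ (RGenOpens.measurableE R)).
move=> _ [_ [a [b ->] <-]]; rewrite setTI.
by apply: sub_sigma_algebra; exact/(iffLR (continuousP _) fcts)/interval_open.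
Qed.

Lemma measurable_corr_prod (R : realType) r (m : 'I_r -> int) (k : int) :
  measurable_fun [set: borel_full_shift]
    (fun x : borel_full_shift => (corr_prod m x k)%:~R : R).
Proof.
by apply: continuous_measurable_full_shift; exact: continuous_corr_prod.
Qed.

Lemma measurable_tm_hull : measurable (tm_hull : set borel_full_shift).
Proof.
rewrite -[tm_hull]setCK; apply: measurableC; apply: sub_sigma_algebra.
by apply: (@closed_openC full_shift); exact: closed_closure.
Qed.

(** The product topology is the supremum of the initial topologies of the projections, so
    neighbourhoods can be tested one coordinate at a time. *)
Lemma continuous_into_prod (T : topologicalType) (I : Type)
    (K : I -> topologicalType) (f : T -> prod_topology K) :
  (forall i, continuous (fun x => f x i)) -> continuous f.
Proof.
move=> fcts x; apply/cvg_sup => i A.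
have /= -> := @nbhsE (initial_topology (fun g : prod_topology K => g i)) (f x).
move=> [B [[C oC <-] Cfx]] /filterS; apply.
by apply: (fcts i x); apply: open_nbhs_nbhs; split.
Qed.

Lemma continuous_shift_pow (i : int) : continuous (shift_pow i).
Proof.
apply: (@continuous_into_prod full_shift int (fun=> discrete_topology pm1)) => j.
exact: continuous_coord.
Qed.

Lemma measurable_shift_pow (i : int) :
  measurable_fun [set: borel_full_shift]
    (shift_pow i : borel_full_shift -> borel_full_shift).
Proof.
apply: (@measurability _ _ borel_full_shift borel_full_shift setT _
  (@open full_shift)) => //.
move=> _ [A oA <-]; rewrite setTI; apply: sub_sigma_algebra.
exact: (iffLR (continuousP _) (continuous_shift_pow i) A oA).
Qed.

(** * From the word to its hull and to invariant measures *)

Lemma corr_prod_shift r (m : 'I_r -> int) (x : full_shift) (i k : int) :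
  corr_prod m (shift_pow i x) k = corr_prod m x (k + i).
Proof.
rewrite /corr_prod /letter /shift_pow; congr (_ * _).
by apply: eq_bigr => j _; rewrite addrAC.
Qed.

(** The bound is a closed condition on [x], as a finite sum of correlation products is continuous.
    It holds on the orbit of [tm_word], where shifting the word moves the window, hence on the
    closure. *)
Lemma corr_prod_sum_hull (R : realType) r (m : 'I_r -> int) (N : nat) (b : R) :
  (forall a : int,
    `|(\sum_(0 <= k < N) corr_prod m tm_word (a + k%:Z))%:~R : R| <= b) ->
  forall x, tm_hull x ->
    `|\sum_(0 <= k < N) ((corr_prod m x k%:Z)%:~R : R)| <= b.
Proof.
move=> wb; pose g (x : full_shift) : R := `|\sum_(0 <= k < N) (corr_prod m x k%:Z)%:~R|.
have gcts : continuous g.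
  move=> x; apply: continuous_comp; last exact: norm_continuous.
  apply: (@continuous_big R _ _ 0 xpredT (@add_continuous R)) => k _.
  exact: continuous_corr_prod.
have gcl : closed [set x | g x <= b].
  exact: (iffLR (continuous_closedP _) gcts _ (@closed_le R b)).
apply: (@subset_trans _ (closure [set x | g x <= b])); last first.
  by rewrite -((closure_id _).1 gcl).
apply: closureS => _ [i _ <-]; rewrite /= /g.
have := wb i; rewrite rmorph_sum; congr (`|_| <= _); apply: eq_bigr => k _.
by rewrite corr_prod_shift addrC.
Qed.

Lemma integrable_corr_prod (R : realType) (mu : probability borel_full_shift R)
    (D : set borel_full_shift) r (m : 'I_r -> int) (k : int) :
  measurable D ->
  mu.-integrable D (fun x : borel_full_shift => ((corr_prod m x k)%:~R : R)%:E).
Proof.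
move=> mD; apply: measurable_bounded_integrable => //.
- by rewrite (le_lt_trans (probability_le1 mu mD)) ?ltry.
- by apply: measurable_funTS; exact: measurable_corr_prod.
- exists 1; split=> // b b1 x _ /=.
  by rewrite -intr_norm normr_corr_prod ltW.
Qed.

(** The complement of the hull is null. Integrals thus move to the full shift, where the change of
    variables takes place. *)
Lemma integral_tm_hull (R : realType) (mu : probability borel_full_shift R)
    (f : borel_full_shift -> \bar R) :
  tm_invariant_measure mu ->
  mu.-integrable setT f ->
  (\int[mu]_(x in tm_hull) f x = \int[mu]_(x in setT) f x)%E.
Proof.
move=> mu_inv intf; rewrite (@negligible_integral _ _ _ mu setT (~` tm_hull)) //.
- by rewrite setDE setCK setTI.
- by apply: measurableC; exact: measurable_tm_hull.
- have := probability_setC mu measurable_tm_hull.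
  by rewrite mu_inv.1 subee.
Qed.

(** Reading [x] at [k + 1] is reading its shift at [k], and [mu] agrees with its pushforward under
    the shift on measurable sets. *)
Lemma integral_corr_prod_shift (R : realType) (mu : probability borel_full_shift R)
    r (m : 'I_r -> int) (k : nat) :
  tm_invariant_measure mu ->
  (\int[mu]_(x in tm_hull) ((corr_prod m x k%:Z)%:~R)%:E = eta mu m)%E.
Proof.
move=> mu_inv; have intf j := @integrable_corr_prod R mu setT r m j measurableT.
elim: k => [//|k <-]; rewrite !integral_tm_hull //.
pose S : borel_full_shift -> borel_full_shift := shift_pow 1.
have mS : measurable_fun setT S by exact: measurable_shift_pow.
transitivity (\int[pushforward mu S]_(x in setT)
    ((corr_prod m x k%:Z)%:~R)%:E)%E; last first.
  apply: (@eq_measure_integral _ _ _ _ mu) => A mA _; exact: mu_inv.2.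
rewrite integral_pushforward //.
- apply: eq_integral => x _ /=.
  by rewrite corr_prod_shift -addn1 PoszD.
- by apply/measurable_EFinP; exact: measurable_corr_prod.
- rewrite preimage_setT; apply: eq_integrable (intf (k%:Z + 1)) => // x _ /=.
  by rewrite corr_prod_shift.
Qed.

(** By shift invariance, [N] times the correlation is the integral of the window sum of length [N],
    which is bounded pointwise on a hull of mass 1. *)
Lemma eta_bound (R : realType) (mu : probability borel_full_shift R)
    r (m : 'I_r -> int) (N : nat) (b : R) :
  tm_invariant_measure mu -> 0 <= b ->
  (forall a : int,
    `|(\sum_(0 <= k < N) corr_prod m tm_word (a + k%:Z))%:~R : R| <= b) ->
  (N%:R%:E * `|eta mu m| <= b%:E)%E.
Proof.
move=> mu_inv b0 wb; have mH := measurable_tm_hull.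
rewrite -[(N%:R%:E)%E]gee0_abs ?lee_fin // -abseM.
have -> : (N%:R%:E * eta mu m = \int[mu]_(x in tm_hull)
    (\sum_(0 <= k < N) ((corr_prod m x k%:Z)%:~R : R))%:E)%E.
  under eq_integral do rewrite -sumEFin.
  have intf (k : nat) := integrable_corr_prod R mu _ r m k%:Z mH.
  rewrite (@integral_sum _ _ _ mu _ mH _ _ intf).
  rewrite (eq_bigr (fun=> eta mu m)) => [|k _]; last exact: integral_corr_prod_shift.
  by rewrite sumr_const_nat subn0 mule_natl.
pose S : borel_full_shift -> \bar R := fun x =>
  (\sum_(0 <= k < N) (corr_prod m x k%:Z)%:~R)%:E.
have mS : measurable_fun (tm_hull : set borel_full_shift) S.
  apply/measurable_EFinP; apply: measurable_sum => k.
  by apply: measurable_funTS; exact: measurable_corr_prod.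
apply: (le_trans (le_abse_integral mu mH mS)).
apply: (le_trans (@integral_le_bound _ _ _ mu _ _ b%:E mH mS _ _)).
- by rewrite lee_fin.
- by apply: aeW => x xH; rewrite lee_fin; exact: corr_prod_sum_hull.
- by rewrite [X in (b%:E * X)%E]mu_inv.1 mule1.
Qed.

Theorem corollary4p4 (R : realType) (n : nat) (hn : odd n)
    (m : 'I_n.-1 -> int) :
  (forall mu : probability borel_full_shift R,
     tm_invariant_measure mu -> eta mu m = 0%E) /\
  (eta_average R m N @[N --> \oo] --> (0 : R)).
Proof.
(* The base point is one of the [n] points, so an odd [n] means an even number of shifts. *)
have n1 : ~~ odd n.-1 by case: n hn {m} => [//|n] /=.
split=> [mu mu_inv|].
- apply/eqP; rewrite -abse_eq0 eq_le abse_ge0 andbT.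
  apply/lee_addgt0Pr => e e0; rewrite add0e.
  have [N0 small] := corr_prod_average_small R _ m e n1 e0.
  (* The successor makes the window length positive, so that it can be cancelled. *)
  have small1 := small N0.+1 _ (leqnSn _).
  have := eta_bound R mu _ m N0.+1 _ mu_inv (mulr_ge0 (ltW e0) (ler0n _ _)) small1.
  rewrite mulrC EFinM.
  by rewrite lee_pmul2l // ?lte_fin ?ltr0n.
- apply/cvgrPdist_le => e e0; rewrite /=.
  have [N0 small] := corr_prod_average_small R _ m e n1 e0.
  exists N0.+1 => // N /= N0N; rewrite sub0r normrN /eta_average.
  have N_gt0 : 0 < N%:R :> R by rewrite ltr0n; lia.
  rewrite normrM ger0_norm ?invr_ge0 ?ler0n // ler_pdivrMl // mulrC.
  (* The averages along the word use the windows starting at 0. *)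
  have := small N 0 (ltnW N0N); rewrite rmorph_sum.
  by under eq_bigr do rewrite add0r.
Qed.
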